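(* There is a polynomial-time algorithm that solves Monopolar Extension for instances $(G,(C',I'))$ where $C'$ is a vertex modulator of $G$ to chair-free graphs. If $G$ has a monopolar partition that is an extension of $(C',I')$, then this algorithm also outputs one such partition.
   Context: All graphs are finite, simple and undirected. A graph is a cluster graph if each connected component is complete. A partition $V=C\uplus I$ of the vertex set of $G=(V,E)$ is a monopolar partition if $G[C]$ is a cluster graph and $I$ is independent in $G$. For disjoint $C',I'\subseteq V$, a monopolar partition with $C'\subseteq C$, $I'\subseteq I$ is a monopolar extension of $(C',I')$. Monopolar Extension: given $G$ and $C',I'$, decide whether a monopolar extension of $(C',I')$ exists. The chair is the graph on vertices $a,b,c,d,e$ with edges $ab,bc,bd,de$. A graph is chair-free if it has no induced chair; a set $X\subseteq V$ is a vertex modulator of $G$ to chair-free graphs if $G-X$ is chair-free. *)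

(* Defs.v *)
From mathcomp Require Import all_boot.

Set Implicit Arguments.
Unset Strict Implicit.
Unset Printing Implicit Defensive.

Record sgraph (T : finType) := SGraph {
  adj :> rel T;
  adj_sym : symmetric adj;
  adj_irr : irreflexive adj
}.

Section Graphs.
Variable T : finType.
Implicit Types (G : sgraph T) (A C I : {set T}).

Definition induced G A : sgraph {x : T | x \in A} :=
  @SGraph {x : T | x \in A} (fun x y => G (val x) (val y))
    (fun x y => adj_sym G (val x) (val y)) (fun x => adj_irr G (val x)).

Definition cluster_graph G : Prop :=
  forall x y : T, connect G x y -> x != y -> G x y.

Definition independent G A : Prop := {in A &, forall x y, ~~ G x y}.

Definition induced_copy (S : finType) (H : sgraph S) G : Prop :=
  exists2 f : S -> T, injective f & forall x y, G (f x) (f y) = H x y.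

End Graphs.

Section Monopolar.
Variable T : finType.
Implicit Types (G : sgraph T) (C I X : {set T}).

(* The two parts may be empty. *)
Definition monopolar_partition G C I : Prop :=
  [/\ C :|: I = [set: T], [disjoint C & I],
      cluster_graph (induced G C) & independent G I].

Definition monopolar_extension G (C' I' C I : {set T}) : Prop :=
  [/\ monopolar_partition G C I, C' \subset C & I' \subset I].

End Monopolar.

(* The vertices a, b, c, d, e are 0, 1, 2, 3, 4. *)
Definition chair_edges : seq (nat * nat) := [:: (0, 1); (1, 2); (1, 3); (3, 4)].

Definition chair_adj : rel 'I_5 := fun x y =>
  ((x : nat, y : nat) \in chair_edges) || ((y : nat, x : nat) \in chair_edges).

Lemma chair_adj_sym : symmetric chair_adj.
Proof. by move=> x y; rewrite /chair_adj orbC. Qed.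

Lemma chair_adj_irr : irreflexive chair_adj.
Proof. by case; do 5?case. Qed.

Definition chair : sgraph 'I_5 := SGraph chair_adj_sym chair_adj_irr.

Definition chair_free (T : finType) (G : sgraph T) : Prop :=
  ~ induced_copy chair G.

Definition chair_free_modulator (T : finType) (G : sgraph T) (X : {set T}) :=
  chair_free (induced G (~: X)).

(* Model of computation: a random access machine with structured control.  A
   program uses finitely many scalar variables and finitely many arrays (each
   named by a literal), all holding natural numbers.  Every operation has unit
   cost.  There is no multiplication, so bit lengths grow by at most one per
   operation and unit-cost time is polynomially related to Turing machine
   time. *)
Inductive expr : Type :=
| Const of nat
| Var of nat
| Cell of nat & expr
| Add of expr & expr
| Sub of expr & expr
| Eqb of expr & expr
| Ltb of expr & expr.

Inductive cmd : Type :=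
| Skip
| Assign of nat & expr
| Store of nat & expr & expr
| Seq of cmd & cmd
| If of expr & cmd & cmd
| While of expr & cmd.

Record state := State { var : nat -> nat; cell : nat -> nat -> nat }.

(* [Sub] is truncated; [Eqb] and [Ltb] return 0 or 1. *)
Fixpoint eval (s : state) (e : expr) : nat :=
  match e with
  | Const n => n
  | Var x => var s x
  | Cell a e1 => cell s a (eval s e1)
  | Add e1 e2 => eval s e1 + eval s e2
  | Sub e1 e2 => eval s e1 - eval s e2
  | Eqb e1 e2 => eval s e1 == eval s e2
  | Ltb e1 e2 => eval s e1 < eval s e2
  end.

Fixpoint ecost (e : expr) : nat :=
  match e with
  | Const _ | Var _ => 1
  | Cell _ e1 => (ecost e1).+1
  | Add e1 e2 | Sub e1 e2 | Eqb e1 e2 | Ltb e1 e2 => (ecost e1 + ecost e2).+1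
  end.

Definition set_var (s : state) (x v : nat) : state :=
  State (fun y => if y == x then v else var s y) (cell s).

Definition set_cell (s : state) (a i v : nat) : state :=
  State (var s)
    (fun b j => if (b == a) && (j == i) then v else cell s b j).

(* [exec c s t s']: started in [s], [c] halts after [t] steps in [s'].
   Zero is false, any other value is true. *)
Inductive exec : cmd -> state -> nat -> state -> Prop :=
| exec_skip s : exec Skip s 1 s
| exec_assign s x e :
    exec (Assign x e) s (ecost e).+1 (set_var s x (eval s e))
| exec_store s a e1 e2 :
    exec (Store a e1 e2) s (ecost e1 + ecost e2).+1
      (set_cell s a (eval s e1) (eval s e2))
| exec_seq s1 s2 s3 c1 c2 t1 t2 :
    exec c1 s1 t1 s2 -> exec c2 s2 t2 s3 ->
    exec (Seq c1 c2) s1 (t1 + t2).+1 s3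
| exec_if_true s s' e c1 c2 t :
    eval s e != 0 -> exec c1 s t s' ->
    exec (If e c1 c2) s (ecost e + t).+1 s'
| exec_if_false s s' e c1 c2 t :
    eval s e = 0 -> exec c2 s t s' ->
    exec (If e c1 c2) s (ecost e + t).+1 s'
| exec_while_true s1 s2 s3 e c t1 t2 :
    eval s1 e != 0 -> exec c s1 t1 s2 -> exec (While e c) s2 t2 s3 ->
    exec (While e c) s1 (ecost e + t1 + t2).+1 s3
| exec_while_false s e c :
    eval s e = 0 -> exec (While e c) s (ecost e).+1 s.

Lemma exec_det c s t1 s1 t2 s2 :
  exec c s t1 s1 -> exec c s t2 s2 -> t1 = t2 /\ s1 = s2.
Proof.
move=> E1; elim: E1 t2 s2 => {c s t1 s1}.
- by move=> s t2 s2 E; inversion E.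
- by move=> s x e t2 s2 E; inversion E.
- by move=> s a e1 e2 t2 s2 E; inversion E.
- move=> s1 s2 s3 c1 c2 t1 t2 _ IH1 _ IH2 t s E; inversion E; subst.
  match goal with H : exec c1 _ _ _ |- _ => case: (IH1 _ _ H) => ? ?; subst end.
  by match goal with H : exec c2 _ _ _ |- _ => case: (IH2 _ _ H) => -> -> end.
- move=> s s' e c1 c2 t He _ IH t2 s2 E; inversion E; subst.
    by match goal with H : exec c1 _ _ _ |- _ => case: (IH _ _ H) => -> -> end.
  by match goal with H : eval _ _ = 0 |- _ => rewrite H in He end.
- move=> s s' e c1 c2 t He _ IH t2 s2 E; inversion E; subst.
    by match goal with H : is_true (eval _ _ != 0) |- _ => rewrite He in H end.
  by match goal with H : exec c2 _ _ _ |- _ => case: (IH _ _ H) => -> -> end.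
- move=> s1 s2 s3 e c t1 t2 He _ IH1 _ IH2 t s E; inversion E; subst.
    match goal with H : exec c _ _ _ |- _ => case: (IH1 _ _ H) => ? ?; subst end.
    by match goal with H : exec (While _ _) _ _ _ |- _ =>
      case: (IH2 _ _ H) => -> -> end.
  by match goal with H : eval _ _ = 0 |- _ => rewrite H in He end.
- move=> s e c He t2 s2 E; inversion E; subst => //.
  by match goal with H : is_true (eval _ _ != 0) |- _ => rewrite He in H end.
Qed.

Definition poly_bounded (f : nat -> nat) : Prop :=
  exists c k, forall n, f n <= c * n ^ k + c.

(* Initial memory on an instance with vertices 0, ..., n - 1: variable 0 holds
   n, array 0 the adjacency matrix in row-major order, arrays 1 and 2 the
   characteristic vectors of C' and I'; everything else is 0.  The input length
   is quadratic in n, so "polynomial" may be measured in n. *)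
Definition input (n : nat) (G : sgraph 'I_n) (C' I' : {set 'I_n}) : state :=
  State
    (fun x => if x == 0 then n else 0)
    (fun a i => match a with
      | 0 => [exists u : 'I_n, exists v : 'I_n, (i == u * n + v) && G u v]
      | 1 => [exists v in C', i == v]
      | 2 => [exists v in I', i == v]
      | _ => false
      end).

(* Final memory: variable 1 holds the answer (nonzero means yes), array 3 the
   partition, with value 1 on C and value 0 on I. *)
Definition answers_yes (s : state) : Prop := var s 1 != 0.

Definition output_C (n : nat) (s : state) : {set 'I_n} :=
  [set v : 'I_n | cell s 3 v == 1].

Definition output_I (n : nat) (s : state) : {set 'I_n} :=
  [set v : 'I_n | cell s 3 v == 0].

(* Main.v *)
Require Import Defs.
From mathcomp Require Import all_boot.
From mathcomp Require Import zify.

Set Implicit Arguments.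
Unset Strict Implicit.
Unset Printing Implicit Defensive.

(* Write x_v for "v is in I".  The problem consists of the clauses ~x_u \/ ~x_v for
   every edge uv, x_a \/ x_b \/ x_c for every induced path on a, b, c, and the units
   given by C' and I'.  The three-literal clauses are replaced by two-literal ones:
   if x and y are adjacent (or x = y is in C') and both {v, w, x} and {v, w, y} induce
   a path, then x_v \/ x_w; and if b has degree at least 3 and ab is an edge in no
   triangle, with a and b outside C', then x_a \/ x_b.  The second rule holds in every
   extension with I inclusion-maximal: if a and b were in C, two further neighbours of
   b and a neighbour of a in I would complete ab to an induced chair outside C'.
   Conversely, a solution of this 2-SAT instance in which each vertex outside I and C'
   has a neighbour in I hits every induced path.

   Negative clauses being edges or loops E and all the others being positive pairs P,
   the instance is solved greedily: a vertex v is added to J, together with everything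
   that E and P then imply, whenever the result stays E-independent.  If J satisfies
   the clauses it is the inclusion-maximal solution needed above.

   The running time comes from a small language of loops over the vertices whose
   assignments are first-order formulas; each of its programs compiles to a
   polynomial-time machine program. *)

(** * Greedy solution of two-literal clauses *)

Section TwoSat.
Variables (T : finType) (E P : rel T).
Implicit Types (J K S : {set T}) (u v w x : T).

Definition indep_set S := [forall u in S, forall v in S, ~~ E u v].

Definition covering S := [forall u, forall v, P u v ==> (u \in S) || (v \in S)].

Definition sat_solution S := indep_set S && covering S.

(** One round of unit propagation: a member [u] of [K] excludes [x] through [E], and then the pair
    [P x w] forces [w]. *)
Definition implied K w := [exists u in K, exists x, E u x && P x w].

Definition implied_closed K := forall w, implied K w -> w \in K.

Definition propagate K := [set w | (w \in K) || implied K w].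

Definition implied_closure K := iter #|T| propagate K.

Definition try_add J v :=
  let K := implied_closure (v |: J) in if indep_set K then K else J.

Definition greedy (s : seq T) := foldl try_add set0 s.

Lemma indep_setP S : reflect {in S &, forall u v, ~~ E u v} (indep_set S).
Proof.
apply: (iffP forall_inP) => [H u v uS vS|H u uS].
  by move/forall_inP: (H u uS); apply.
by apply/forall_inP => v vS; apply: H.
Qed.

Lemma coveringP S :
  reflect (forall u v, P u v -> u \in S \/ v \in S) (covering S).
Proof.
apply: (iffP forallP) => [H u v Puv|H u].
  by move/forallP: (H u) => /(_ v) /implyP /(_ Puv) /orP.
by apply/forallP => v; apply/implyP => /H /orP.
Qed.

Lemma impliedP K w :
  reflect (exists u x, [/\ u \in K, E u x & P x w]) (implied K w).
Proof.
apply: (iffP exists_inP) => [[u uK /existsP[x /andP[Eux Pxw]]]|].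
  by exists u, x.
by case=> u [x [uK Eux Pxw]]; exists u => //; apply/existsP; exists x; apply/andP.
Qed.

Lemma indep_setS J S : J \subset S -> indep_set S -> indep_set J.
Proof.
move=> /subsetP sJS /indep_setP H; apply/indep_setP => u v uJ vJ.
by apply: H; apply: sJS.
Qed.

Lemma sub_propagate K : K \subset propagate K.
Proof. by apply/subsetP => x; rewrite inE => ->. Qed.

Lemma sub_implied_closure K : K \subset implied_closure K.
Proof.
rewrite /implied_closure; elim: #|T| => //= m IH.
exact: subset_trans IH (sub_propagate _).
Qed.

(** A round that changes the set adds an element, so [#|T|] rounds reach a fixed point. *)
Lemma implied_closure_closed K : implied_closed (implied_closure K).
Proof.
(* The strict bound can start at [k = 0] because the empty set is stationary; at [k = #|T|] it is
   impossible. *)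
have fix_iter k : k < #|iter k propagate K| \/
    propagate (iter k propagate K) = iter k propagate K.
  elim: k => [|k [IH|IH]] /=; last by right; rewrite !IH.
    have [/eqP|Kn] := posnP #|K|; last by left.
    rewrite cards_eq0 => /eqP ->; right; apply/setP => w; rewrite !inE /=.
    by apply/negbTE/impliedP => -[u [x []]]; rewrite inE.
  set L := iter k propagate K in IH *.
  have := sub_propagate L; rewrite subEproper => /orP[/eqP eqL|/proper_card cL].
    by right; rewrite -!eqL.
  by left; apply: leq_trans cL.
have closureP : propagate (implied_closure K) = implied_closure K.
  by case: (fix_iter #|T|) => //; rewrite ltnNge max_card.
by move=> w wI; rewrite -closureP inE wI orbT.
Qed.

Hypotheses (Esym : symmetric E) (Psym : symmetric P).

Lemma implied_closure_sub_solution S K :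
  sat_solution S -> K \subset S -> implied_closure K \subset S.
Proof.
case/andP => /indep_setP Eind /coveringP Pcov KS.
rewrite /implied_closure; elim: #|T| => //= m IH; apply/subsetP => w.
rewrite inE => /orP[/(subsetP IH)//|/impliedP[u [x [uK Eux Pxw]]]].
case: (Pcov _ _ Pxw) => // xS.
by have := Eind u x (subsetP IH _ uK) xS; rewrite Eux.
Qed.

(** [S] gives way to [J] wherever they conflict. If [u] in [S] is dropped because [E y u] for some
    [y] in [J], every [P]-partner of [u] is implied by [y], hence lies in [J] by closedness. *)
Lemma solution_override J S :
  implied_closed J -> indep_set J -> sat_solution S ->
  sat_solution (J :|: [set x in S | [forall u in J, ~~ E u x]]).
Proof.
move=> clJ /indep_setP iJ /andP[/indep_setP iS /coveringP cS].
apply/andP; split.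
  apply/indep_setP => u v.
  rewrite !inE => /orP[uJ|/andP[uS /forall_inP uN]] /orP[vJ|/andP[vS /forall_inP vN]].
  - exact: iJ.
  - exact: vN.
  - by rewrite Esym; exact: uN.
  - exact: iS.
apply/coveringP.
have half u v : P u v -> u \in S -> u \in J :|: [set x in S | [forall y in J, ~~ E y x]]
    \/ v \in J :|: [set x in S | [forall y in J, ~~ E y x]].
  move=> Puv uS; rewrite !inE uS /=.
  have [|] := boolP [forall y in J, ~~ E y u]; first by rewrite orbT; left.
  case/forall_inPn => y yJ /negPn Eyu; right; apply/orP; left; apply: clJ.
  by apply/impliedP; exists y, u.
move=> u v Puv; case: (cS _ _ Puv) => [uS|vS]; first exact: half.
by rewrite Psym in Puv; case: (half _ _ Puv vS); [right|left].
Qed.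

Lemma greedy_closed s : implied_closed (greedy s) /\ indep_set (greedy s).
Proof.
elim/last_ind: s => [|s v [clJ iJ]]; last first.
  rewrite /greedy foldl_rcons -/(greedy s) /try_add.
  by case: ifP => // iK; split => //; apply: implied_closure_closed.
split=> [w /impliedP[u [x []]]|]; first by rewrite inE.
by apply/indep_setP => u v; rewrite inE.
Qed.

Lemma sub_try_add J v : J \subset try_add J v.
Proof.
rewrite /try_add; case: ifP => // _.
by apply: subset_trans (sub_implied_closure _); apply: subsetUr.
Qed.

(** When [v] was tried, [v] and the set built so far lay in [S]; so did their closure, which was
    therefore independent, and [v] was accepted. *)
Lemma solution_sub_greedy S s :
  sat_solution S -> greedy s \subset S -> {in s, forall v, v \in S -> v \in greedy s}.
Proof.
move=> solS; elim/last_ind: s => [|s x IH] // sS v.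
rewrite mem_rcons inE => /orP vs vS; move: sS.
rewrite /greedy foldl_rcons -/(greedy s) => sS.
have sS' := subset_trans (sub_try_add _ _) sS.
case: vs => [/eqP eqv|vs]; last first.
  by apply: (subsetP (sub_try_add _ _)); apply: IH.
subst v; rewrite /try_add.
have clS : implied_closure (x |: greedy s) \subset S.
  by apply: implied_closure_sub_solution => //; rewrite subUset sub1set vS.
case/andP: (solS) => iS _; rewrite (indep_setS clS iS).
by apply: (subsetP (sub_implied_closure _)); rewrite !inE eqxx.
Qed.

Lemma greedy_maximal S :
  sat_solution S -> greedy (enum T) \subset S -> S = greedy (enum T).
Proof.
move=> solS sS; apply/eqP; rewrite eqEsubset sS andbT.
by apply/subsetP => v vS; apply: (solution_sub_greedy solS) => //; rewrite mem_enum.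
Qed.

(** Overriding any solution by the greedy set gives a solution containing the greedy set, which by
    maximality is the greedy set itself. *)
Lemma greedy_solution S : sat_solution S -> sat_solution (greedy (enum T)).
Proof.
move=> solS; have [clJ iJ] := greedy_closed (enum T).
have sol := solution_override clJ iJ solS.
by rewrite -(greedy_maximal sol) // subsetUl.
Qed.

End TwoSat.

(** * Reduction of monopolar extension *)

Section Reduction.
Variables (T : finType) (G : sgraph T) (C' I' : {set T}).
Implicit Types (J S : {set T}) (a b c u v w x y z : T).

Definition is_P3 a b c := [&& G a b, G b c, a != c & ~~ G a c].

Definition induces_P3 a b c := [|| is_P3 a b c, is_P3 b a c | is_P3 a c b].

(** A loop at a vertex of [C'] encodes the unit clause keeping it out of the independent part. *)
Definition conflict x y := G x y || (x == y) && (x \in C').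

(* Valid only in inclusion-maximal extensions; this is where chair-freeness is used. *)
Definition pendant_clause b a :=
  [&& a \notin C', b \notin C', G a b, ~~ [exists z, G a z && G b z] &
    [exists x, exists y, [&& G b x, G b y, x != y, x != a & y != a]]].

(** Diagonal pairs encode the units of [I']. In the second disjunct [x] and [y] cannot both lie in
    the independent part, so one of the two paths must be hit in [v] or [w]; the case [x = y] treats
    a path through [C']. *)
Definition clause v w :=
  [|| (v == w) && (v \in I'),
      [exists x, exists y, [&& conflict x y, induces_P3 v w x & induces_P3 v w y]],
      pendant_clause v w | pendant_clause w v].

Definition P3_free (C : {set T}) :=
  forall a b c, a \in C -> b \in C -> c \in C -> ~~ is_P3 a b c.

Lemma is_P3C a b c : is_P3 a b c = is_P3 c b a.
Proof.
rewrite /is_P3 (adj_sym G a b) (adj_sym G b c) (adj_sym G a c) eq_sym.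
by rewrite andbCA.
Qed.

Lemma induces_P3C a b c : induces_P3 a b c = induces_P3 b a c.
Proof. by rewrite /induces_P3 orbCA (is_P3C a c b). Qed.

Lemma conflict_sym : symmetric conflict.
Proof.
by move=> x y; rewrite /conflict adj_sym eq_sym; case: eqP => // ->.
Qed.

Lemma clause_sym : symmetric clause.
Proof.
move=> v w; rewrite /clause eq_sym (orbC (pendant_clause v w)).
congr [|| _, _ | _]; first by case: eqP => // ->.
by do 2!apply: eq_existsb => ?; rewrite !(induces_P3C v w).
Qed.

Lemma adj_neq x y : G x y -> x != y.
Proof. by apply: contraTneq => ->; rewrite adj_irr. Qed.

Lemma cluster_induced_P3_free (C : {set T}) :
  cluster_graph (induced G C) <-> P3_free C.
Proof.
split=> [cl a b c aC bC cC|free [x xC] [y yC]].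
  apply/negP => /and4P[Gab Gbc nac /negP]; apply.
  apply: (cl (exist _ a aC) (exist _ c cC)); last by rewrite -val_eqE.
  apply: (@connect_trans _ _ (exist _ b bC)); exact: connect1.
(* Induction along the walk: its penultimate vertex [w] equals [x] or is adjacent to it, and in the
   latter case non-adjacent distinct [x] and [y] would make [x], [w], [y] an induced path. *)
case/connectP => p; elim/last_ind: p y yC => [|p z IH] y yC /=.
  by move=> _ ->; rewrite eqxx.
rewrite rcons_path last_rcons => /andP[pp e] ez; subst z.
case: (last _ p) (IH _ (valP (last (exist _ x xC) p))) e => w wC /= IHw Gwy.
move=> nxy.
have [eqw|nxw] := eqVneq x w; first by subst w; rewrite /=.
have Gxw : G x w.
  by apply: IHw => //; apply: val_inj.
apply: contraT => nG; case/negP: (free x w y xC wC yC).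
by rewrite /is_P3 Gxw Gwy nG andbT.
Qed.

(** A boolean form, with the cluster part as complement, so that [maxset] supplies inclusion-maximal
    extensions. *)
Definition extension S :=
  [&& C' \subset ~: S, I' \subset S, indep_set G S &
    [forall a in ~: S, forall b in ~: S, forall c in ~: S, ~~ is_P3 a b c]].

Lemma P3_freeP (C : {set T}) :
  reflect (P3_free C)
    [forall a in C, forall b in C, forall c in C, ~~ is_P3 a b c].
Proof.
apply: (iffP forall_inP) => [H a b c aC bC cC|H a aC].
  by move/forall_inP: (H a aC) => /(_ b bC) /forall_inP /(_ c cC).
by apply/forall_inP => b bC; apply/forall_inP => c cC; apply: H.
Qed.

Lemma extensionP S :
  extension S <-> monopolar_extension G C' I' (~: S) S.
Proof.
split.
  case/and4P=> sC sI /indep_setP iS /P3_freeP free; split=> //; split=> //.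
  - by rewrite setUC setUCr.
  - by rewrite -setI_eq0 setIC setICr.
  - exact/cluster_induced_P3_free.
case=> -[_ _ /cluster_induced_P3_free free iS] sC sI.
by apply/and4P; split=> //; [apply/indep_setP|apply/P3_freeP].
Qed.

Lemma extension_of C I : monopolar_extension G C' I' C I -> extension I.
Proof.
move=> ext; apply/extensionP; suff <- : C = ~: I by [].
case: ext => -[cov dis _ _] _ _.
apply/setP => x; rewrite inE; have := in_setT x; rewrite -cov inE.
by case: (boolP (x \in C)) => [xC _|_ /= ->] //; rewrite (disjointFr dis xC).
Qed.

Lemma induces_P3_extension S a b c :
  extension S -> induces_P3 a b c -> [|| a \in S, b \in S | c \in S].
Proof.
case/and4P=> _ _ _ /P3_freeP free; apply: contraTT; rewrite !negb_or.
by case/and3P=> aS bS cS; rewrite !free ?inE.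
Qed.

Lemma conflict_extension S :
  extension S -> indep_set conflict S.
Proof.
case/and4P=> /subsetP sC _ /indep_setP iS _; apply/indep_setP => u v uS vS.
rewrite /conflict negb_or iS //= negb_and.
by have [/sC|//] := boolP (u \in C'); rewrite ?orbT // inE uS.
Qed.

(** The vertex of degree three is [b], and [e] hangs on [a]; in the order [x], [b], [y], [a], [e]
    the vertices match 0 to 4 of [chair]. *)
Lemma chair_witness b x y a e :
  [&& b \notin C', x \notin C', y \notin C', a \notin C' & e \notin C'] ->
  [&& G x b, G b y, G b a & G a e] ->
  [&& ~~ G x y, ~~ G x a, ~~ G x e, ~~ G b e, ~~ G y a & ~~ G y e] ->
  [&& x != y, x != a, y != a, b != e & x != e] -> y != e ->
  ~ chair_free_modulator G C'.
Proof.
case/and5P=> bC xC yC aC eC /and4P[xb yb ab ae].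
case/and5P=> xy xa xe be /andP[ya ye] /and5P[nxy nxa nya nbe nxe] nye; apply.
have nxb := adj_neq xb; have nby := adj_neq yb.
have nba := adj_neq ab; have nae := adj_neq ae.
have inN z : z \notin C' -> z \in ~: C' by rewrite inE.
pose pts : 5.-tuple {z : T | z \in ~: C'} :=
  [tuple exist _ x (inN _ xC); exist _ b (inN _ bC); exist _ y (inN _ yC);
         exist _ a (inN _ aC); exist _ e (inN _ eC)].
exists (tnth pts).
  apply/tuple_uniqP; rewrite -(map_inj_uniq val_inj) /= !inE !negb_or.
  by rewrite nxb nxy nxa nxe nby nba nbe nya nye nae.
move=> i j; rewrite -[RHS]/(chair_adj i j) /= !(tnth_nth (exist _ x (inN _ xC))) /=.
case: i => i; case: j => j /=; rewrite /chair_adj.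
have sG := adj_sym G.
do 5?[case: i => [|i]] => //; do 5?[case: j => [|j]] => //= _ _;
  rewrite ?adj_irr ?xb ?yb ?ab ?ae ?(negbTE xy) ?(negbTE xa) ?(negbTE xe) ?(negbTE be)
    ?(negbTE ya) ?(negbTE ye) //; by rewrite sG;
  rewrite ?xb ?yb ?ab ?ae ?(negbTE xy) ?(negbTE xa) ?(negbTE xe) ?(negbTE be)
    ?(negbTE ya) ?(negbTE ye).
Qed.

(** Otherwise [v |: S] would be a larger extension. *)
Lemma maxset_extension_neighbor S v :
  maxset extension S -> v \notin S -> v \notin C' -> exists2 u, u \in S & G v u.
Proof.
case/maxsetP=> /and4P[sC sI iS free] maxS vS vC.
have [/existsP[u /andP[uS Gvu]]|none] := boolP [exists u, (u \in S) && G v u].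
  by exists u.
case/negP: (vS); rewrite -(maxS (v |: S)) ?setU11 ?subsetUr //.
have nG u : u \in S -> ~~ G v u.
  by move=> uS; apply: contra none => Gvu; apply/existsP; exists u; rewrite uS.
apply/and4P; split.
- apply/subsetP => x xC; rewrite !inE negb_or.
  have := subsetP sC _ xC; rewrite inE => ->; rewrite andbT.
  by apply: contraNneq vC => <-.
- exact: subset_trans sI (subsetUr _ _).
- apply/indep_setP => x y; rewrite !inE.
  case/orP=> [/eqP->|xS] /orP[/eqP->|yS].
  + by rewrite adj_irr.
  + exact: nG.
  + by rewrite adj_sym nG.
  + by move/indep_setP: iS; apply.
- have sub : ~: (v |: S) \subset ~: S by rewrite setCS subsetUr.
  move/P3_freeP: free => free; apply/P3_freeP => a b c aC bC cC.
  by apply: free; apply: (subsetP sub).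
Qed.

Lemma pendant_clause_extension S b a :
  chair_free_modulator G C' -> maxset extension S -> pendant_clause b a ->
  (b \in S) || (a \in S).
Proof.
move=> cf maxS /and5P[aC bC Gab nocommon /existsP[x /existsP[y]]].
case/and5P=> Gbx Gby nxy nxa nya.
have ext := maxsetp maxS; have [sC _ iS _] := and4P ext.
move/indep_setP: iS => iS.
have noC z : z \in S -> z \notin C'.
  by move=> zS; apply: contraL zS => /(subsetP sC); rewrite inE.
apply: contraT; rewrite negb_or => /andP[bS aS].
have noG z : G b z -> ~~ G a z.
  move=> Gbz; apply: contra nocommon => Gaz; apply/existsP; exists z.
  by rewrite Gaz.
(* As [ab] lies in no triangle, [a], [b], [z] is an induced path, and only [z] can hit it. *)
have inS z : G b z -> z != a -> z \in S.
  move=> Gbz nza; have : induces_P3 a b z.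
    by rewrite /induces_P3 /is_P3 Gab Gbz eq_sym nza noG.
  by move/(induces_P3_extension ext); rewrite (negbTE aS) (negbTE bS).
have [xS yS] := (inS _ Gbx nxa, inS _ Gby nya).
have [e eS Gae] := maxset_extension_neighbor maxS aS aC.
case: (@chair_witness b x y a e) => //.
- by rewrite bC aC !noC.
- by rewrite adj_sym Gbx Gby adj_sym Gab.
- rewrite (iS x y) // (iS x e) // (iS y e) // !(adj_sym G _ a) !noG //= andbT.
  by apply: contraL Gae; apply: noG.
- rewrite nxy nxa nya /=; apply/andP; split.
    by apply: contraNneq bS => ->.
  by apply: contraTneq Gae => <-; apply: noG.
- by apply: contraTneq Gae => <-; apply: noG.
Qed.

(** The passage to an inclusion-maximal extension makes the pendant clauses hold. *)
Lemma extension_solution S :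
  chair_free_modulator G C' -> extension S ->
  exists J, sat_solution conflict clause J.
Proof.
move=> cf /maxset_exists[J maxJ _]; exists J.
have ext := maxsetp maxJ; rewrite /sat_solution conflict_extension //=.
apply/coveringP => v w /or4P[/andP[_ vI]|/existsP[x /existsP[y]]|N|N].
- by left; case/and4P: ext => _ /subsetP sI _ _; apply: sI.
- case/and3P=> cxy /(induces_P3_extension ext) + /(induces_P3_extension ext).
  case: (v \in J); first by left.
  case: (w \in J); first by right.
  move=> /= xJ yJ; move/indep_setP: (conflict_extension ext) => /(_ x y xJ yJ).
  by rewrite cxy.
- by case/orP: (pendant_clause_extension cf maxJ N); auto.
- by case/orP: (pendant_clause_extension cf maxJ N); auto.
Qed.

Lemma solution_extension J :
  sat_solution conflict clause J ->
  (forall v, v \notin J -> v \notin C' -> exists2 u, u \in J & G v u) ->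
  extension J.
Proof.
case/andP=> /indep_setP iJ /coveringP cJ nbr.
have sC : C' \subset ~: J.
  apply/subsetP => v vC; rewrite inE; apply/negP => vJ.
  by have := iJ v v vJ vJ; rewrite /conflict eqxx vC orbT.
have notcl v w : v \notin J -> w \notin J -> ~~ clause v w.
  by move=> vJ wJ; apply/negP => /cJ; rewrite (negbTE vJ) (negbTE wJ) => -[].
apply/and4P; split=> //.
- apply/subsetP => v vI; apply: contraT => vJ; case/negP: (notcl v v vJ vJ).
  by rewrite /clause eqxx vI.
- apply/indep_setP => u v uJ vJ; have := iJ u v uJ vJ.
  by rewrite negb_or => /andP[].
apply/P3_freeP => a b c; rewrite !inE => aJ bJ ncJ; apply/negP => abc.
have [Gab Gbc nac Gac] := and4P abc.
have Gba : G b a by rewrite adj_sym.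
(* Two induced paths that share [v], [w] outside [J] and have conflicting third vertices violate
   [clause v w]; taking [x = y] in [C'] yields [loop]. *)
have pair v w x y : v \notin J -> w \notin J -> conflict x y ->
    induces_P3 v w x -> induces_P3 v w y -> False.
  move=> vJ wJ cxy px py; case/negP: (notcl v w vJ wJ); apply/or4P/Or42.
  by apply/existsP; exists x; apply/existsP; exists y; rewrite cxy px py.
have loop v w x : v \notin J -> w \notin J -> induces_P3 v w x -> x \notin C'.
  move=> vJ wJ px; apply/negP => xC; apply: (pair v w x x) => //.
  by rewrite /conflict eqxx xC orbT.
have pac_b : induces_P3 a c b by rewrite /induces_P3 abc !orbT.
have pbc_a : induces_P3 b c a by rewrite /induces_P3 (is_P3C b a c) (is_P3C c b a) abc orbT.
have aC := loop _ _ _ bJ ncJ pbc_a.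
have bC := loop _ _ _ aJ ncJ pac_b.
(* A common neighbour [z] of [a] and [b] would contradict [pair]: with the paths on [a], [c] and
   either [b] or [z] if [z] is adjacent to [c], and otherwise with those on [b], [c] and either [a]
   or [z]. *)
have far z : G b z -> z != c -> ~~ G a z.
  move=> Gbz nzc; apply/negP => Gaz.
  have [Gzc|Gzc] := boolP (G z c).
    apply: (pair a c b z) => //; first by rewrite /conflict Gbz.
    by rewrite /induces_P3 /is_P3 Gaz Gzc nac Gac !orbT.
  apply: (pair b c a z) => //; first by rewrite /conflict Gaz.
  by rewrite /induces_P3 /is_P3 (adj_sym G c b) Gbc Gbz (eq_sym c) nzc (adj_sym G c z) Gzc orbT.
have [d dJ Gbd] := nbr b bJ bC.
have nda : d != a by apply: contraNneq aJ => <-.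
have ndc : d != c by apply: contraNneq ncJ => <-.
(* Now [ab] lies in no triangle and [b] has the further neighbours [c] and [d], so the pendant
   clause on [b], [a] is violated. *)
case/negP: (notcl b a bJ aJ); apply/or4P/Or43/and5P; split=> //.
  apply/existsP => -[z /andP[Gaz Gbz]].
  have nzc : z != c by apply: contraNneq Gac => <-.
  by move: (far z Gbz nzc); rewrite Gaz.
apply/existsP; exists c; apply/existsP; exists d.
by rewrite Gbc Gbd eq_sym ndc eq_sym nac nda.
Qed.

Definition greedy_part := greedy conflict clause (enum T).

(** A vertex outside [C'] and the greedy set without a neighbour in that set could be added with all
    clauses kept, against maximality; this gives the neighbours that [solution_extension] asks
    for. *)
Lemma greedy_part_extension :
  covering clause greedy_part -> extension greedy_part.
Proof.
move=> cov; have [_ iJ] := greedy_closed conflict clause (enum T).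
have sol : sat_solution conflict clause greedy_part by apply/andP.
apply: solution_extension => // v vJ vC.
have [/existsP[u /andP[uJ Gvu]]|none] := boolP [exists u, (u \in greedy_part) && G v u].
  by exists u.
case/negP: (vJ).
suff solv : sat_solution conflict clause (v |: greedy_part).
  by rewrite -[greedy_part](greedy_maximal solv) ?setU11 ?subsetUr.
have nG u : u \in greedy_part -> ~~ conflict v u.
  move=> uJ; rewrite negb_or; apply/andP; split.
    by apply: contra none => Gvu; apply/existsP; exists u; rewrite uJ.
  by rewrite negb_and vC orbT.
apply/andP; split; last first.
  apply/coveringP => x y /(coveringP _ _ cov) [] xJ; rewrite !inE xJ orbT; auto.
apply/indep_setP => x y; rewrite !inE.
case/orP=> [/eqP->|xJ] /orP[/eqP->|yJ].
- by rewrite /conflict adj_irr (negbTE vC) andbF.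
- exact: nG.
- by rewrite conflict_sym nG.
- by move/indep_setP: iJ; apply.
Qed.

Lemma covering_greedy_part :
  chair_free_modulator G C' -> (exists S, extension S) -> covering clause greedy_part.
Proof.
move=> cf [S /(extension_solution cf)[J sol]].
by case/andP: (greedy_solution conflict_sym clause_sym sol).
Qed.

End Reduction.

(** * Polynomial-time programs from first-order formulas *)

(** Powers of [n.+1] are positive, so constants are absorbed and sums and products need no case for
    [n = 0]. *)
Definition poly_growth (f : nat -> nat) := exists c k, forall n, f n <= c * n.+1 ^ k.

Lemma poly_growth_cst c : poly_growth (fun=> c).
Proof. by exists c, 0 => n; rewrite muln1. Qed.

Lemma poly_growth_id : poly_growth id.
Proof. by exists 1, 1 => n; rewrite mul1n expn1. Qed.

Lemma poly_growthM f g :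
  poly_growth f -> poly_growth g -> poly_growth (fun n => f n * g n).
Proof.
case=> c [k Hf] [d [l Hg]]; exists (c * d), (k + l) => n.
by rewrite expnD mulnACA leq_mul.
Qed.

Lemma poly_growthD f g :
  poly_growth f -> poly_growth g -> poly_growth (fun n => f n + g n).
Proof.
case=> c [k Hf] [d [l Hg]]; exists (c + d), (k + l) => n.
rewrite mulnDl expnD leq_add // ?(leq_trans (Hf n)) ?(leq_trans (Hg n)) //.
  by rewrite leq_mul // leq_pmulr ?expn_gt0.
by rewrite leq_mul // leq_pmull ?expn_gt0.
Qed.

(** For positive [n], [n.+1 ^ k] is at most [2 ^ k * n ^ k]; the additive constant covers
    [n = 0]. *)
Lemma poly_growth_bounded f : poly_growth f -> poly_bounded f.
Proof.
case=> c [k Hf]; exists (c * 2 ^ k), k => n; apply: leq_trans (Hf n) _.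
rewrite -[X in _ + X]muln1 -mulnDr -mulnA leq_mul //; case: n => [|n].
  by rewrite exp1n muln_gt0 expn_gt0 addn1.
apply: (@leq_trans (2 ^ k * n.+1 ^ k)); last by rewrite leq_mul // leq_addr.
rewrite -expnMn; case: k {Hf} => // k; rewrite leq_exp2r // mul2n -addnn.
by rewrite addSn addnS !ltnS leq_addr.
Qed.

(** * Total correctness with time bounds for machine programs *)

Definition runs c s B (Q : state -> Prop) :=
  exists t s', [/\ exec c s t s', t <= B & Q s'].

Lemma runs_weaken c s B B' (Q Q' : state -> Prop) :
  runs c s B Q -> B <= B' -> (forall s', Q s' -> Q' s') -> runs c s B' Q'.
Proof.
case=> t [s' [ex le_t Qs']] le_B sQ; exists t, s'; split=> //; last exact: sQ.
exact: leq_trans le_B.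
Qed.

Lemma runs_assign x e s (Q : state -> Prop) :
  Q (set_var s x (eval s e)) -> runs (Assign x e) s (ecost e).+1 Q.
Proof. by move=> Qs; do 2!eexists; split; [exact: exec_assign| |]. Qed.

Lemma runs_store a e1 e2 s (Q : state -> Prop) :
  Q (set_cell s a (eval s e1) (eval s e2)) ->
  runs (Store a e1 e2) s (ecost e1 + ecost e2).+1 Q.
Proof. by move=> Qs; do 2!eexists; split; [exact: exec_store| |]. Qed.

Lemma runs_seq c1 c2 s B1 B2 (Q1 Q2 : state -> Prop) :
  runs c1 s B1 Q1 -> (forall s1, Q1 s1 -> runs c2 s1 B2 Q2) ->
  runs (Seq c1 c2) s (B1 + B2).+1 Q2.
Proof.
case=> t1 [s1 [ex1 le1 Qs1]] /(_ s1 Qs1) [t2 [s2 [ex2 le2 Qs2]]].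
exists (t1 + t2).+1, s2; split=> //; first exact: exec_seq ex1 ex2.
by rewrite ltnS leq_add.
Qed.

(* Variable 0 holds the number n of vertices throughout. *)
Definition for_loop k c :=
  Seq (Assign k (Const 0))
    (While (Ltb (Var k) (Var 0)) (Seq c (Assign k (Add (Var k) (Const 1))))).

(** The invariant speaks of the state after the increment. A round costs 9 beyond the body: 3 for
    the test, 4 for the increment, 1 each for the sequence and the loop. The last 9 covers the
    initialization and the failing test. *)
Lemma runs_for n B k c (Inv : nat -> state -> Prop) s :
  (forall i s, Inv i s -> var s 0 = n) ->
  (forall i s, i < n -> Inv i s -> var s k = i ->
    runs c s B (fun s' => var s' k = i /\ Inv i.+1 (set_var s' k i.+1))) ->
  Inv 0 (set_var s k 0) -> runs (for_loop k c) s (n * (B + 9) + 9) (Inv n).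
Proof.
move=> Inv0 body Inv_s.
suff loop m i s1 : i + m = n -> Inv i s1 -> var s1 k = i ->
    runs (While (Ltb (Var k) (Var 0)) (Seq c (Assign k (Add (Var k) (Const 1)))))
      s1 (m * (B + 9) + 4) (Inv n).
  apply: (@runs_weaken _ _ (2 + (n * (B + 9) + 4)).+1 _ (Inv n)) => //.
    apply: (runs_seq (Q1 := fun s' => Inv 0 s' /\ var s' k = 0)).
      by apply: runs_assign; rewrite /= eqxx.
    by move=> s1 [I1 v1]; apply: (loop n 0).
  lia.
elim: m i s1 => [|m IH] i s1.
  rewrite addn0 => -> In vk; exists 4, s1; split=> //.
  by apply: exec_while_false; rewrite /= vk (Inv0 _ _ In) ltnn.
move=> im Ii vk; have lt_in : i < n by rewrite -im addnS ltnS leq_addr.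
have [t1 [s2 [ex1 le1 [vk2 I2]]]] := body i s1 lt_in Ii vk.
have [] := IH i.+1 (set_var s2 k i.+1) _ I2; rewrite ?addSnnS //= ?eqxx //.
move=> t2 [s3 [ex2 le2 I3]].
exists (3 + (t1 + 4).+1 + t2).+1, s3; split=> //.
  apply: (exec_while_true (t1 := (t1 + 4).+1)) ex2.
    by rewrite /= vk (Inv0 _ _ Ii) lt_in.
  apply: exec_seq ex1 _.
  have <- : eval s2 (Add (Var k) (Const 1)) = i.+1 by rewrite /= vk2 addn1.
  exact: exec_assign.
lia.
Qed.

(* First-order formulas over the graph with unary predicates (arrays); variables
   are de Bruijn indices into an environment of vertices. *)
Inductive form : Type :=
| Pred of nat & nat
| Adj of nat & nat
| Same of nat & nat
| Neg of form
| And of form & form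
| Ex of form.

(* A dangling index denotes n, which is not a vertex. *)
Fixpoint sat n (h : nat -> nat -> nat) (r : seq nat) (f : form) : bool :=
  match f with
  | Pred a i => h a (nth n r i) != 0
  | Adj i j => h 0 (nth n r i * n + nth n r j) != 0
  | Same i j => nth n r i == nth n r j
  | Neg f => ~~ sat n h r f
  | And f g => sat n h r f && sat n h r g
  | Ex f => has (fun i => sat n h (i :: r) f) (iota 0 n)
  end.

(* [k] receives the truth value; registers from [k] on are scratch, [R] lists the
   registers of the free variables. *)
Fixpoint compile_form (R : seq nat) (k : nat) (f : form) : cmd :=
  match f with
  | Pred a i => Assign k (Ltb (Const 0) (Cell a (Var (nth 0 R i))))
  | Adj i j =>
      Seq (Assign k (Const 0))
        (Seq (for_loop k.+1 (Assign k (Add (Var k) (Var (nth 0 R i)))))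
          (Assign k (Ltb (Const 0) (Cell 0 (Add (Var k) (Var (nth 0 R j)))))))
  | Same i j => Assign k (Eqb (Var (nth 0 R i)) (Var (nth 0 R j)))
  | Neg f => Seq (compile_form R k f) (Assign k (Eqb (Var k) (Const 0)))
  | And f g =>
      Seq (compile_form R k f)
        (Seq (compile_form R k.+1 g)
          (Assign k (Ltb (Const 1) (Add (Var k) (Var k.+1)))))
  | Ex f =>
      Seq (Assign k (Const 0))
        (for_loop k.+1
          (Seq (compile_form (k.+1 :: R) k.+2 f)
            (Assign k (Ltb (Const 0) (Add (Var k) (Var k.+2))))))
  end.

Fixpoint form_time (f : form) (n : nat) : nat :=
  match f with
  | Pred _ _ => 5
  | Same _ _ => 4
  | Adj _ _ => n * (4 + 9) + 30
  | Neg f => form_time f n + 5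
  | And f g => form_time f n + form_time g n + 8
  | Ex f => n * (form_time f n + 16) + 12
  end.

Lemma form_time_poly f : poly_growth (form_time f).
Proof.
elim: f => /= *; do !(exact: poly_growth_cst || exact: poly_growth_id ||
  assumption || apply: poly_growthD || apply: poly_growthM).
Qed.

Definition unchanged_below k s s' := forall r, r < k -> var s' r = var s r.

Lemma unchanged_below_trans k s1 s2 s3 :
  unchanged_below k s1 s2 -> unchanged_below k s2 s3 -> unchanged_below k s1 s3.
Proof. by move=> H1 H2 r lt_r; rewrite H2 ?H1. Qed.

Lemma unchanged_set_var k x v s : k <= x -> unchanged_below k s (set_var s x v).
Proof. by move=> le_k r lt_r /=; rewrite ltn_eqF // (leq_trans lt_r). Qed.

Lemma map_var_unchanged k R s s' :
  all (gtn k) R -> unchanged_below k s s' -> map (var s') R = map (var s) R.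
Proof. by move=> /allP Rk H; apply/eq_in_map => r /Rk; apply: H. Qed.

(** The default register 0 holds [n], which is also the default vertex value, so dangling indices
    agree. *)
Lemma var_nth n s R i : var s 0 = n -> var s (nth 0 R i) = nth n (map (var s) R) i.
Proof.
move=> s0; have [lt_i|ge_i] := ltnP i (size R); first by rewrite (nth_map 0).
by rewrite !nth_default ?size_map.
Qed.

Lemma has_iotaS (a : pred nat) m : has a (iota 0 m.+1) = has a (iota 0 m) || a m.
Proof. by rewrite -(addn1 m) iotaD has_cat /= orbF. Qed.

(** The preserved registers below [k] protect bound variables and earlier partial results while
    subformulas are evaluated. *)
Lemma runs_compile_form n f R k s :
  0 < k -> all (gtn k) R -> var s 0 = n ->
  runs (compile_form R k f) s (form_time f n)
    (fun s' => [/\ cell s' = cell s, unchanged_below k s s'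
      & var s' k = sat n (cell s) (map (var s) R) f]).
Proof.
elim: f R k s => [a i|i j|i j|f IH|f IHf g IHg|f IH] R k s k0 Rk s0 /=.
- apply: runs_assign; rewrite /= eqxx (var_nth _ _ s0) lt0n; split=> //.
  exact: unchanged_set_var.
- apply: (@runs_weaken _ _ (2 + ((n * (4 + 9) + 9) + 7).+1).+1 _ _ _ _ _ (fun _ => id)).
    apply: (runs_seq (Q1 := fun s' => [/\ cell s' = cell s, unchanged_below k s s'
        & var s' k = 0])).
      by apply: runs_assign; split=> //=; [exact: unchanged_set_var|rewrite eqxx].
    move=> s1 [c1 u1 v1].
    apply: (runs_seq (Q1 := fun s' => [/\ cell s' = cell s, unchanged_below k s s'
        & var s' k = nth n (map (var s) R) i * n])); last first.
      move=> s2 [c2 u2 v2]; have s20 : var s2 0 = n by rewrite u2.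
      apply: runs_assign; split=> //=.
        exact: unchanged_below_trans u2 (unchanged_set_var _ _ _).
      by rewrite eqxx v2 (var_nth _ _ s20) (map_var_unchanged Rk u2) c2 lt0n.
    (* Without multiplication, the row offset in the adjacency matrix is formed by [n] additions. *)
    pose Inv m s' := [/\ cell s' = cell s, unchanged_below k s s'
        & var s' k = nth n (map (var s) R) i * m].
    apply: (@runs_for n 4 k.+1 _ Inv).
    + by move=> m s2 [_ u2 _]; rewrite u2.
    + move=> m s2 lt_m [c2 u2 v2] vk2; apply: runs_assign => /=.
      have s20 : var s2 0 = n by rewrite u2.
      rewrite gtn_eqF // vk2; split=> //; split=> //=.
        move=> r lt_r /=; rewrite !ltn_eqF ?u2 //.
        exact: leq_trans lt_r _.
      by rewrite ltn_eqF // eqxx v2 (var_nth _ _ s20) (map_var_unchanged Rk u2) mulnSr.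
    + split=> //=; last by rewrite ltn_eqF // v1 muln0.
      by apply: unchanged_below_trans u1 (unchanged_set_var _ _ _).
  lia.
- apply: runs_assign; rewrite /= eqxx !(var_nth _ _ s0); split=> //.
  exact: unchanged_set_var.
- apply: (@runs_weaken _ _ (form_time f n + 4).+1 _ _ _ _ _ (fun _ => id)); last first.
    lia.
  apply: runs_seq (IH R k s k0 Rk s0) _ => s1 [c1 u1 v1].
  apply: runs_assign; split=> //=.
    exact: unchanged_below_trans u1 (unchanged_set_var _ _ _).
  by rewrite eqxx v1; case: sat.
- apply: (@runs_weaken _ _ (form_time f n + (form_time g n + 6).+1).+1 _ _ _ _ _ (fun _ => id)); last first.
    lia.
  apply: runs_seq (IHf R k s k0 Rk s0) _ => s1 [c1 u1 v1].
  have s10 : var s1 0 = n by rewrite u1.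
  have Rk1 : all (gtn k.+1) R by apply: sub_all Rk => x /= /ltnW.
  apply: runs_seq (IHg R k.+1 s1 isT Rk1 s10) _ => s2 [c2 u2 v2].
  have u02 : unchanged_below k s s2.
    by apply: unchanged_below_trans u1 _ => r /ltnW; apply: u2.
  apply: runs_assign; split=> /=; first by rewrite c2.
    exact: unchanged_below_trans u02 (unchanged_set_var _ _ _).
  rewrite eqxx v2 u2 // v1 c1 (map_var_unchanged Rk u1).
  by do 2!case: sat.
- pose B := (form_time f n + 6).+1.
  apply: (@runs_weaken _ _ (2 + (n * (B + 9) + 9)).+1 _ _ _ _ _ (fun _ => id)); last first.
    rewrite /B; lia.
  apply: (runs_seq (Q1 := fun s' => [/\ cell s' = cell s, unchanged_below k s s'
      & var s' k = 0])).
    by apply: runs_assign; split=> //=; [exact: unchanged_set_var|rewrite eqxx].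
  move=> s1 [c1 u1 v1].
  pose Inv m s' := [/\ cell s' = cell s, unchanged_below k s s'
      & var s' k = has (fun i => sat n (cell s) (i :: map (var s) R) f) (iota 0 m)].
  apply: (@runs_for n B k.+1 _ Inv).
  + by move=> m s2 [_ u2 _]; rewrite u2.
  + move=> m s2 lt_m [c2 u2 v2] vk2; have s20 : var s2 0 = n by rewrite u2.
    have Rk2 : all (gtn k.+2) (k.+1 :: R).
      by rewrite /= ltnSn /=; apply: sub_all Rk => x /= lt_x; rewrite ltnS ltnW // ltnW.
    apply: runs_seq (IH (k.+1 :: R) k.+2 s2 isT Rk2 s20) _ => s3 [c3 u3 v3].
    apply: runs_assign => /=; rewrite gtn_eqF // u3 // vk2; split=> //.
    rewrite /Inv has_iotaS; split=> /=; first by rewrite c3.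
      move=> r lt_r /=; rewrite !ltn_eqF ?u3 ?u2 //.
        by rewrite !ltnS ltnW // ltnW.
      exact: leq_trans lt_r _.
    rewrite ltn_eqF // eqxx u3 // v2 v3 c2 /= vk2 (map_var_unchanged Rk u2).
    by case: has; case: sat.
  + split=> //=; last by rewrite ltn_eqF.
    by apply: unchanged_below_trans u1 (unchanged_set_var _ _ _).
Qed.

(** * Programs of vertex loops and their compilation *)

Inductive prog : Type :=
| Put of nat & form
| Then of prog & prog
| Loop of prog.

Definition write (h : nat -> nat -> nat) (a i v : nat) :=
  fun b j => if (b == a) && (j == i) then v else h b j.

(* [Put] writes at the vertex bound by the innermost loop. *)
Fixpoint denote n (r : seq nat) (p : prog) (h : nat -> nat -> nat) :=
  match p with
  | Put a f => write h a (nth n r 0) (sat n h r f)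
  | Then p q => denote n r q (denote n r p h)
  | Loop p => iteri n (fun i => denote n (i :: r) p) h
  end.

Fixpoint compile (R : seq nat) (k : nat) (p : prog) : cmd :=
  match p with
  | Put a f => Seq (compile_form R k f) (Store a (Var (nth 0 R 0)) (Var k))
  | Then p q => Seq (compile R k p) (compile R k q)
  | Loop p => for_loop k (compile (k :: R) k.+1 p)
  end.

Fixpoint prog_time (p : prog) (n : nat) : nat :=
  match p with
  | Put _ f => form_time f n + 4
  | Then p q => prog_time p n + prog_time q n + 1
  | Loop p => n * (prog_time p n + 9) + 9
  end.

Lemma prog_time_poly p : poly_growth (prog_time p).
Proof.
elim: p => /= *; do !(exact: poly_growth_cst || exact: poly_growth_id ||
  exact: form_time_poly || assumption || apply: poly_growthD || apply: poly_growthM).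
Qed.

Lemma runs_compile n p R k s :
  0 < k -> all (gtn k) R -> var s 0 = n ->
  runs (compile R k p) s (prog_time p n)
    (fun s' => cell s' = denote n (map (var s) R) p (cell s)
      /\ unchanged_below k s s').
Proof.
elim: p R k s => [a f|p IHp q IHq|p IH] R k s k0 Rk s0 /=.
- rewrite addnS; apply: runs_seq (runs_compile_form f k0 Rk s0) _ => s1 [c1 u1 v1].
  have s10 : var s1 0 = n by rewrite u1.
  apply: runs_store; split=> /=; last by move=> r /u1.
  by rewrite c1 v1 (var_nth _ _ s10) (map_var_unchanged Rk u1).
- rewrite addn1; apply: runs_seq (IHp R k s k0 Rk s0) _ => s1 [c1 u1].
  have s10 : var s1 0 = n by rewrite u1.
  apply: runs_weaken (IHq R k s1 k0 Rk s10) (leqnn _) _ => s2 [c2 u2].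
  rewrite c2 c1 (map_var_unchanged Rk u1); split=> //.
  exact: unchanged_below_trans u1 u2.
- pose Inv m s' := cell s' = iteri m (fun i => denote n (i :: map (var s) R) p) (cell s)
    /\ unchanged_below k s s'.
  apply: (@runs_for n (prog_time p n) k _ Inv).
  + by move=> m s2 [_ u2]; rewrite u2.
  + move=> m s2 lt_m [c2 u2] vk2; have s20 : var s2 0 = n by rewrite u2.
    have Rk2 : all (gtn k.+1) (k :: R).
      by rewrite /= ltnSn /=; apply: sub_all Rk => x /= /ltnW.
    apply: runs_weaken (IH (k :: R) k.+1 s2 isT Rk2 s20) (leqnn _) _ => s3 [c3 u3].
    rewrite u3 // vk2; split=> //; split=> /=.
      by rewrite c3 c2 /= vk2 (map_var_unchanged Rk u2).
    move=> r lt_r /=; rewrite ltn_eqF // u3 ?u2 //; exact: ltnW.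
  + by split=> //; apply: unchanged_set_var.
Qed.

(** * The algorithm *)

Fixpoint reads (f : form) : seq nat :=
  match f with
  | Pred a _ => [:: a]
  | Adj _ _ => [:: 0]
  | Same _ _ => [::]
  | Neg f | Ex f => reads f
  | And f g => reads f ++ reads g
  end.

Lemma eq_sat n f h h' r :
  {in reads f, forall a, h a =1 h' a} -> sat n h r f = sat n h' r f.
Proof.
elim: f r => [a i|i j|//|f IH|f IHf g IHg|f IH] r eqh /=.
- by rewrite eqh // inE.
- by rewrite eqh // inE.
- by rewrite IH.
- by rewrite IHf ?IHg // => a ain; apply: eqh; rewrite mem_cat ain ?orbT.
- by apply: eq_has => i; apply: IH.
Qed.

Lemma denote_Then n r p q h : denote n r (Then p q) h = denote n r q (denote n r p h).
Proof. by []. Qed.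

Lemma denote_Loop n r p h :
  denote n r (Loop p) h = iteri n (fun i => denote n (i :: r) p) h.
Proof. by []. Qed.

Definition update a f := Loop (Put a f).

(** Since [f] does not read [a], earlier writes of the loop do not affect later values: all vertices
    are updated as if at once. *)
Lemma denote_update n r a f h b j : a \notin reads f ->
  denote n r (update a f) h b j =
    if (b == a) && (j < n) then sat n h (j :: r) f : nat else h b j.
Proof.
move=> aNf /=.
(* Only the loop bound and the range test are generalized; the domain of [sat] keeps size [n]. *)
elim: {1 3}n b j => [|m IH] b j /=; first by rewrite andbF.
rewrite /write ltnS leq_eqVlt; case: (eqVneq b a) => [->|nb] /=; last first.
  by rewrite IH (negbTE nb).
case: eqVneq => [->|nj] /=; last by rewrite IH eqxx.
congr nat_of_bool; apply: eq_sat => c cf d; rewrite IH.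
by case: eqVneq cf aNf => // -> ->.
Qed.

Lemma sat_And n h r f g : sat n h r (And f g) = sat n h r f && sat n h r g.
Proof. by []. Qed.

Lemma sat_Neg n h r f : sat n h r (Neg f) = ~~ sat n h r f.
Proof. by []. Qed.

Definition Or f g := Neg (And (Neg f) (Neg g)).

Lemma sat_Or n h r f g : sat n h r (Or f g) = sat n h r f || sat n h r g.
Proof. by rewrite /= negb_and !negbK. Qed.

Lemma sat_Ex n h r f : sat n h r (Ex f) = [exists x : 'I_n, sat n h (val x :: r) f].
Proof.
apply/hasP/existsP => [[i]|[x fx]].
  by rewrite mem_iota /= add0n => lt_i fi; exists (Ordinal lt_i).
by exists (val x) => //; rewrite mem_iota /= add0n.
Qed.

Definition conflict_form i j := Or (Adj i j) (And (Same i j) (Pred 1 i)).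

Definition is_P3_form a b c :=
  And (Adj a b) (And (Adj b c) (And (Neg (Same a c)) (Neg (Adj a c)))).

Definition induces_P3_form a b c :=
  Or (is_P3_form a b c) (Or (is_P3_form b a c) (is_P3_form a c b)).

(** Parameters are shifted once per quantifier crossed; in the last part [x] has index 1 and [y]
    index 0. *)
Definition pendant_form b a :=
  And (Neg (Pred 1 a)) (And (Neg (Pred 1 b)) (And (Adj a b)
    (And (Neg (Ex (And (Adj a.+1 0) (Adj b.+1 0))))
      (Ex (Ex (And (Adj b.+2 1) (And (Adj b.+2 0)
        (And (Neg (Same 1 0)) (And (Neg (Same 1 a.+2)) (Neg (Same 0 a.+2))))))))))).

Definition clause_form v w :=
  Or (And (Same v w) (Pred 2 v))
    (Or (Ex (Ex (And (conflict_form 1 0)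
          (And (induces_P3_form v.+2 w.+2 1) (induces_P3_form v.+2 w.+2 0)))))
      (Or (pendant_form v w) (pendant_form w v))).

(** Under both quantifiers, 2 is the candidate [w], 1 the source in array 5, and 0 the excluded
    vertex. *)
Definition implied_form :=
  Ex (And (Pred 5 0) (Ex (And (conflict_form 1 0) (clause_form 0 2)))).

Definition indep_form :=
  Neg (Ex (And (Pred 5 0) (Ex (And (Pred 5 0) (conflict_form 1 0))))).

Definition covering_form :=
  Neg (Ex (Ex (And (clause_form 1 0) (And (Neg (Pred 4 1)) (Neg (Pred 4 0)))))).

(* Array 4 holds the greedy set, array 5 the closure under computation; array 6 is a
   buffer that makes the updates simultaneous. *)
Definition propagate_prog :=
  Then (update 6 (Or (Pred 5 0) implied_form)) (update 5 (Pred 6 0)).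

(** In [Same 0 1], index 1 is the vertex being tried. The language has no conditional: the closed
    formula [indep_form] selects which of arrays 5 and 4 is copied. *)
Definition try_add_prog :=
  Then (update 5 (Or (Same 0 1) (Pred 4 0)))
    (Then (Loop propagate_prog)
      (Then (update 6 (Or (And indep_form (Pred 5 0)) (And (Neg indep_form) (Pred 4 0))))
        (update 4 (Pred 6 0)))).

Definition greedy_prog := Then (Loop try_add_prog) (update 3 (Neg (Pred 4 0))).

(** With scratch starting at register 1, the value of [covering_form] lands in the answer
    variable. *)
Definition monopolar_cmd :=
  Seq (compile [::] 1 greedy_prog) (compile_form [::] 1 covering_form).

(** * Agreement of the programs with the greedy algorithm *)

Section Correctness.
Variables (n : nat) (G : sgraph 'I_n) (C' I' : {set 'I_n}).
Implicit Types (h : nat -> nat -> nat) (S J K : {set 'I_n}) (r : seq nat).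

Definition represents h a S := forall v : 'I_n, (h a v != 0) = (v \in S).

Definition holds_instance h :=
  [/\ forall u v : 'I_n, (h 0 (u * n + v) != 0) = G u v,
      represents h 1 C' & represents h 2 I'].

Local Notation conflict := (conflict G C').
Local Notation clause := (clause G C' I').

Lemma holds_instance_input : holds_instance (cell (input G C' I')).
Proof.
split=> [u v|v|v] /=; rewrite eqb0 negbK.
- apply/existsP/idP => [[x /existsP[y /andP[/eqP exy Gxy]]]|Guv]; last first.
    by exists u; apply/existsP; exists v; rewrite eqxx.
  have n0 : 0 < n by apply: leq_trans (ltn_ord u).
  (* Quotient and remainder by [n] recover row and column. *)
  have eu : u = x.
    apply: val_inj; have /= := congr1 (divn^~ n) exy.
    by rewrite !divnMDl // !divn_small ?ltn_ord ?addn0.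
  have ev : v = y.
    apply: val_inj; have /= := congr1 (modn^~ n) exy.
    by rewrite !modnMDl !modn_small ?ltn_ord.
  by rewrite eu ev.
- apply/exists_inP/idP => [[x xC /eqP/val_inj->]|vC] //.
  by exists v.
- apply/exists_inP/idP => [[x xC /eqP/val_inj->]|vC] //.
  by exists v.
Qed.

(** The condition [2 < a] keeps the arrays of the instance intact. *)
Lemma update_spec r a f h :
  a \notin reads f -> 2 < a -> holds_instance h ->
  [/\ holds_instance (denote n r (update a f) h),
      represents (denote n r (update a f) h) a
        [set w : 'I_n | sat n h (val w :: r) f]
    & forall b S, b != a -> represents h b S ->
        represents (denote n r (update a f) h) b S].
Proof.
move=> aNf a2 [hG hC hI].
have frame b j : b != a -> denote n r (update a f) h b j = h b j.
  by move=> nb; rewrite denote_update // (negbTE nb).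
have below b : b < 3 -> b != a by move=> b3; rewrite ltn_eqF // (leq_trans b3).
split; first by split=> [u v|v|v]; rewrite frame ?below // ?hG ?hC ?hI.
- by move=> w; rewrite denote_update // eqxx ltn_ord inE eqb0 negbK.
- by move=> b S nb hb v; rewrite frame.
Qed.

Section Formulas.
Variable h : nat -> nat -> nat.
Hypothesis hh : holds_instance h.

Lemma sat_Adj r i j (u v : 'I_n) :
  nth n r i = u -> nth n r j = v -> sat n h r (Adj i j) = G u v.
Proof. by case: hh => hG _ _ /= -> ->. Qed.

Lemma sat_Same r i j (u v : 'I_n) :
  nth n r i = u -> nth n r j = v -> sat n h r (Same i j) = (u == v).
Proof. by move=> /= -> ->. Qed.

Lemma sat_Pred r a i S (u : 'I_n) :
  represents h a S -> nth n r i = u -> sat n h r (Pred a i) = (u \in S).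
Proof. by move=> hS /= ->. Qed.

Lemma sat_conflict r i j (u v : 'I_n) :
  nth n r i = u -> nth n r j = v -> sat n h r (conflict_form i j) = conflict u v.
Proof.
move=> ri rj; rewrite sat_Or (sat_Adj ri rj).
have [_ hC _] := hh.
by rewrite sat_And (sat_Same ri rj) (sat_Pred hC ri).
Qed.

Lemma sat_is_P3 r i j k (a b c : 'I_n) :
  nth n r i = a -> nth n r j = b -> nth n r k = c ->
  sat n h r (is_P3_form i j k) = is_P3 G a b c.
Proof.
by move=> ri rj rk; rewrite /= ri rj rk; case: hh => hG _ _; rewrite !hG.
Qed.

Lemma sat_induces_P3 r i j k (a b c : 'I_n) :
  nth n r i = a -> nth n r j = b -> nth n r k = c ->
  sat n h r (induces_P3_form i j k) = induces_P3 G a b c.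
Proof.
move=> ri rj rk; rewrite !sat_Or (sat_is_P3 ri rj rk) (sat_is_P3 rj ri rk).
by rewrite (sat_is_P3 ri rk rj).
Qed.

Lemma sat_pendant r i j (b a : 'I_n) :
  nth n r i = b -> nth n r j = a ->
  sat n h r (pendant_form i j) = pendant_clause G C' b a.
Proof.
move=> ri rj; have [_ hC _] := hh.
rewrite /pendant_form !(sat_And, sat_Neg, sat_Ex) (sat_Pred hC ri) (sat_Pred hC rj).
rewrite (sat_Adj rj ri); congr [&& _, _, _, ~~ _ & _]; apply: eq_existsb => x.
  by rewrite sat_And (@sat_Adj _ _ _ a x) // (@sat_Adj _ _ _ b x).
rewrite sat_Ex; apply: eq_existsb => y; rewrite !(sat_And, sat_Neg).
rewrite (@sat_Adj _ _ _ b x) // (@sat_Adj _ _ _ b y) // (@sat_Same _ _ _ x y) //.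
by rewrite (@sat_Same _ _ _ x a) // (@sat_Same _ _ _ y a).
Qed.

Lemma sat_clause r i j (v w : 'I_n) :
  nth n r i = v -> nth n r j = w -> sat n h r (clause_form i j) = clause v w.
Proof.
move=> ri rj; have [_ _ hI] := hh.
rewrite /clause_form sat_Or sat_And (sat_Same ri rj) (sat_Pred hI ri) sat_Or sat_Ex sat_Or.
rewrite (sat_pendant ri rj) (sat_pendant rj ri); congr [|| _, _, _ | _].
apply: eq_existsb => x; rewrite sat_Ex; apply: eq_existsb => y.
rewrite sat_And sat_And (@sat_conflict _ _ _ x y) //.
by rewrite (@sat_induces_P3 _ _ _ _ v w x) // (@sat_induces_P3 _ _ _ _ v w y).
Qed.

Lemma sat_implied r K (w : 'I_n) :
  represents h 5 K -> sat n h (val w :: r) implied_form = implied conflict clause K w.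
Proof.
move=> hK; rewrite sat_Ex; apply: eq_existsb => u.
rewrite sat_And (@sat_Pred _ _ _ K u) // sat_Ex; congr (_ && _).
apply: eq_existsb => x.
by rewrite sat_And (@sat_conflict _ _ _ u x) // (@sat_clause _ _ _ x w).
Qed.

Lemma sat_indep r K :
  represents h 5 K -> sat n h r indep_form = indep_set conflict K.
Proof.
move=> hK; rewrite sat_Neg sat_Ex negb_exists; apply: eq_forallb => u.
rewrite sat_And (@sat_Pred _ _ _ K u) // negb_and implybE; congr (_ || _).
rewrite sat_Ex negb_exists; apply: eq_forallb => v.
by rewrite sat_And (@sat_Pred _ _ _ K v) // (@sat_conflict _ _ _ u v) // negb_and implybE.
Qed.

Lemma sat_covering r J :
  represents h 4 J -> sat n h r covering_form = covering clause J.
Proof.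
move=> hJ; rewrite sat_Neg sat_Ex negb_exists; apply: eq_forallb => u.
rewrite sat_Ex negb_exists; apply: eq_forallb => v.
rewrite sat_And (@sat_clause _ _ _ u v) // sat_And !sat_Neg.
by rewrite (@sat_Pred _ _ _ J u) // (@sat_Pred _ _ _ J v) // -negb_or negb_and negbK implybE.
Qed.

End Formulas.

Lemma propagate_spec r h J K :
  holds_instance h -> represents h 4 J -> represents h 5 K ->
  [/\ holds_instance (denote n r propagate_prog h),
      represents (denote n r propagate_prog h) 4 J
    & represents (denote n r propagate_prog h) 5 (propagate conflict clause K)].
Proof.
move=> hh hJ hK; rewrite /propagate_prog denote_Then.
have [//|//|hh1 h16 fr1] := @update_spec r 6 (Or (Pred 5 0) implied_form) h _ _ hh.
set h1 := denote _ _ _ h in hh1 h16 fr1 *.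
have [//|//|hh2 h25 fr2] := @update_spec r 5 (Pred 6 0) h1 _ _ hh1.
split=> //; first exact/fr2/fr1.
move=> w; rewrite h25 !inE (@sat_Pred h1 _ _ _ _ w h16) // inE sat_Or.
by rewrite (@sat_Pred h _ _ _ K w) // (sat_implied hh _ _ hK).
Qed.

Lemma propagate_loop_spec r h J K :
  holds_instance h -> represents h 4 J -> represents h 5 K ->
  [/\ holds_instance (denote n r (Loop propagate_prog) h),
      represents (denote n r (Loop propagate_prog) h) 4 J
    & represents (denote n r (Loop propagate_prog) h) 5 (implied_closure conflict clause K)].
Proof.
move=> hh hJ hK; rewrite /implied_closure card_ord denote_Loop.
pose it m := iteri m (fun i => denote n (i :: r) propagate_prog) h.
suff loop m : [/\ holds_instance (it m), represents (it m) 4 J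
    & represents (it m) 5 (iter m (propagate conflict clause) K)] by exact: loop.
by elim: m => [|m [IHh IHJ IHK]] //; apply: propagate_spec.
Qed.

Lemma try_add_spec r h J (v : 'I_n) :
  holds_instance h -> represents h 4 J ->
  holds_instance (denote n (val v :: r) try_add_prog h) /\
  represents (denote n (val v :: r) try_add_prog h) 4 (try_add conflict clause J v).
Proof.
move=> hh hJ.
rewrite /try_add_prog !denote_Then.
have [//|//|hh1 h15 fr1] := @update_spec (val v :: r) 5 (Or (Same 0 1) (Pred 4 0)) h _ _ hh.
set h1 := denote _ _ _ h in hh1 h15 fr1 *.
have {}h15 : represents h1 5 (v |: J).
  move=> w; rewrite h15 !inE sat_Or (@sat_Same _ _ _ _ w v) //.
  by rewrite (@sat_Pred _ _ _ _ J w).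
have [hh2 h24 h25] := propagate_loop_spec (val v :: r) hh1 (fr1 4 _ isT hJ) h15.
set h2 := denote _ _ _ h1 in hh2 h24 h25 *.
set K := implied_closure _ _ _ in h25.
pose f := Or (And indep_form (Pred 5 0)) (And (Neg indep_form) (Pred 4 0)).
have [//|//|hh3 h36 _] := @update_spec (val v :: r) 6 f h2 _ _ hh2.
set h3 := denote _ _ _ h2 in hh3 h36 *.
have [//|//|hh4 h44 _] := @update_spec (val v :: r) 4 (Pred 6 0) h3 _ _ hh3.
split=> // w; rewrite h44 inE (@sat_Pred h3 _ _ _ _ w h36) // inE /f sat_Or !sat_And.
rewrite sat_Neg (sat_indep hh2 _ h25) (@sat_Pred _ _ _ _ K w) //.
rewrite (@sat_Pred _ _ _ _ J w) // /try_add -/K.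
by case: indep_set; rewrite ?orbF.
Qed.

Lemma greedy_prog_spec h :
  holds_instance h -> represents h 4 set0 ->
  let h' := denote n [::] greedy_prog h in
  [/\ holds_instance h', represents h' 4 (greedy_part G C' I')
    & forall v : 'I_n, h' 3 v = (v \notin greedy_part G C' I')].
Proof.
move=> hh h0 h'.
have [hh1 h14] : holds_instance (denote n [::] (Loop try_add_prog) h) /\
    represents (denote n [::] (Loop try_add_prog) h) 4 (greedy_part G C' I').
  rewrite denote_Loop.
  pose it m := iteri m (fun i => denote n [:: i] try_add_prog) h.
  (* After [m] rounds the first [m] vertices of [enum 'I_n] have been tried; the bound makes the
     next counter value a vertex. *)
  suff loop m : m <= n -> holds_instance (it m) /\
      represents (it m) 4 (greedy conflict clause (take m (enum 'I_n))).
    by have := loop n (leqnn n); rewrite take_oversize // size_enum_ord.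
  elim: m => [|m IH] lt_m; first by rewrite take0.
  have [IHh IHJ] := IH (ltnW lt_m).
  rewrite (take_nth (Ordinal lt_m)) ?size_enum_ord // /greedy foldl_rcons.
  have -> : nth (Ordinal lt_m) (enum 'I_n) m = Ordinal lt_m.
    exact: (nth_ord_enum _ (Ordinal lt_m)).
  exact: (try_add_spec [::] (Ordinal lt_m)).
rewrite /h' /greedy_prog denote_Then.
set h1 := denote _ _ _ h in hh1 h14 *.
have [//|//|hh2 _ fr] := @update_spec [::] 3 (Neg (Pred 4 0)) h1 _ _ hh1.
split=> //; first exact: fr.
move=> v; rewrite denote_update // eqxx ltn_ord sat_Neg.
by rewrite (@sat_Pred _ _ _ _ _ v h14).
Qed.

End Correctness.

Theorem theorem5 :
  exists (p : cmd) (T : nat -> nat),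
    poly_bounded T /\
    forall (n : nat) (G : sgraph 'I_n) (C' I' : {set 'I_n}),
      [disjoint C' & I'] ->
      chair_free_modulator G C' ->
      exists (t : nat) (s : state),
        [/\ exec p (input G C' I') t s,
            t <= T n,
            answers_yes s <->
              (exists C I : {set 'I_n}, monopolar_extension G C' I' C I)
          & (exists C I : {set 'I_n}, monopolar_extension G C' I' C I) ->
              monopolar_extension G C' I' (output_C n s) (output_I n s)].
Proof.
exists monopolar_cmd, (fun n => prog_time greedy_prog n + form_time covering_form n + 1).
split.
  apply: poly_growth_bounded; apply: poly_growthD (poly_growth_cst 1).
  exact: poly_growthD (prog_time_poly _) (form_time_poly _).
move=> n G C' I' _ cf.
(* Array 4 is initially zero, so the greedy set starts empty. *)
have h0 : @represents n (cell (input G C' I')) 4 set0 by move=> v; rewrite inE.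
have [hh hJ h3] := greedy_prog_spec (holds_instance_input G C' I') h0.
set J := greedy_part G C' I' in hJ h3.
have [t [s [ex le_t [c3 ans]]]] : runs monopolar_cmd (input G C' I')
    (prog_time greedy_prog n + form_time covering_form n + 1)
    (fun s => (forall v : 'I_n, cell s 3 v = (v \notin J)) /\
      var s 1 = covering (clause G C' I') J).
  rewrite addn1; apply: (runs_seq (runs_compile (n := n) _ _ _ _)) => //.
  move=> s1 [c1 u1]; have s10 : var s1 0 = n by rewrite u1.
  apply: runs_weaken (runs_compile_form _ _ _ s10) (leqnn _) _ => //.
  move=> s2 [c2 _ ->]; rewrite c2 c1; split=> //.
  by rewrite (sat_covering hh _ hJ).
exists t, s; split=> //.
  (* A covering greedy set is itself an extension; conversely any extension makes the clauses
     solvable by chair-freeness, and then the greedy set is covering. *)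
  split; rewrite /answers_yes ans eqb0 negbK.
    by move/greedy_part_extension/extensionP => ext; exists (~: J), J.
  by case=> C [I /extension_of ext]; apply: covering_greedy_part => //; exists I.
case=> C [I /extension_of ext].
have -> : output_C n s = ~: J by apply/setP => v; rewrite !inE c3 eqb1.
have -> : output_I n s = J by apply/setP => v; rewrite !inE c3 eqb0 negbK.
apply/extensionP/greedy_part_extension/covering_greedy_part => //; by exists I.
Qed.
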